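(* The integration operator $\int_0^1$ is the unique bounded linear functional on $L^1[0,1]$ such that $\int_0^1 1 = 1$ and \[ \int_0^1 f(x) \, dx = \frac{1}{2} \biggl( \int_0^1 f\Bigl(\frac{x}{2}\Bigr) \, dx + \int_0^1 f\Bigl(\frac{x+1}{2}\Bigr) \, dx \biggr) \] for all $f \in L^1[0,1]$. That is, $\int_0^1$ has these properties, and if $\Phi \colon L^1[0,1] \to \mathbb{F}$ is a bounded linear functional such that $\Phi(1) = 1$ and $\Phi(f) = \frac{1}{2}\bigl(\Phi(x \mapsto f(\frac{x}{2})) + \Phi(x \mapsto f(\frac{x+1}{2}))\bigr)$ for all $f \in L^1[0,1]$, then $\Phi = \int_0^1$.
   Context: $\mathbb{F}$ is a fixed field, either $\mathbb{R}$ or $\mathbb{C}$. $L^1[0,1]$ is the usual Banach space over $\mathbb{F}$ of (a.e. classes of) Lebesgue integrable functions $[0,1] \to \mathbb{F}$, and $1$ also denotes the constant function with value $1$. *)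

(* Defs.v *)
From HB Require Import structures.
From mathcomp Require Import all_boot all_order all_algebra.
From mathcomp Require Import all_classical all_reals all_analysis.
From mathcomp Require Import measurable_realfun complex ring_quotient lra.

Set Implicit Arguments.
Unset Strict Implicit.
Unset Printing Implicit Defensive.

Import Order.TTheory GRing.Theory Num.Theory.
Import numFieldNormedType.Exports.

Local Open Scope classical_set_scope.
Local Open Scope ring_scope.
Local Open Scope complex_scope.

(* The base field is [R] or [R[i]], for [R] a model of the real numbers. *)
Variant scalars := RealScalars | ComplexScalars.

Definition base_field (R : realType) (k : scalars) : numFieldType :=
  match k with
  | RealScalars => R
  | ComplexScalars => R[i]
  end.

Section Scalars.
Variable R : realType.

Definition re k : base_field R k -> R :=
  match k with RealScalars => id | ComplexScalars => @complex.Re R end.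

Definition im k : base_field R k -> R :=
  match k with RealScalars => fun=> 0 | ComplexScalars => @complex.Im R end.

(* [mkscalar k a b] is [a + i b]; over the reals the argument [b] is dropped. *)
Definition mkscalar k : R -> R -> base_field R k :=
  match k with
  | RealScalars => fun a _ => a
  | ComplexScalars => fun a b => a +i* b
  end.

Definition modulus k (z : base_field R k) : R := re `|z|.

Variable k : scalars.
Implicit Types z w : base_field R k.

Lemma mkscalar_reim z : mkscalar k (re z) (im z) = z.
Proof. by case: k z => //= -[]. Qed.

Lemma re_mkscalar a b : re (mkscalar k a b) = a.
Proof. by case: k. Qed.

Lemma reD z w : re (z + w) = re z + re w.
Proof. by case: k z w => //= -[? ?] [? ?]. Qed.

Lemma imD z w : im (z + w) = im z + im w.
Proof. by case: k z w => /= [? ?|[? ?] [? ?]//]; rewrite addr0. Qed.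

Lemma reM z w : re (z * w) = re z * re w - im z * im w.
Proof. by case: k z w => /= [? ?|[? ?] [? ?]//]; rewrite mul0r subr0. Qed.

Lemma imM z w : im (z * w) = re z * im w + im z * re w.
Proof. by case: k z w => /= [? ?|[? ?] [? ?]//]; rewrite mulr0 mul0r addr0. Qed.

Lemma re0 : re (0 : base_field R k) = 0. Proof. by case: k. Qed.
Lemma im0 : im (0 : base_field R k) = 0. Proof. by case: k. Qed.

Lemma scalarP z w : re z = re w -> im z = im w -> z = w.
Proof.
by move=> rezw imzw; rewrite -[z]mkscalar_reim -[w]mkscalar_reim rezw imzw.
Qed.

Lemma modulusE z : modulus z = Num.sqrt (re z ^+ 2 + im z ^+ 2).
Proof.
rewrite /modulus; case: k z => /= [z|[a b]].
  by rewrite expr0n/= addr0 sqrtr_sqr.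
exact: (congr1 (@complex.Re R) (normc_def (a +i* b))).
Qed.

Lemma norm_modulus z : `|z| = mkscalar k (modulus z) 0.
Proof. by rewrite /modulus; case: k z. Qed.

Lemma mkscalar_le a b : (mkscalar k a 0 <= mkscalar k b 0) = (a <= b).
Proof. by case: k => //=; rewrite lecR. Qed.

Lemma mkscalar0D a b : mkscalar k a 0 + mkscalar k b 0 = mkscalar k (a + b) 0.
Proof. by apply: scalarP; case: k => //=; rewrite addr0. Qed.

Lemma mkscalar0M a b : mkscalar k a 0 * mkscalar k b 0 = mkscalar k (a * b) 0.
Proof.
by apply: scalarP; case: k => //=; rewrite ?mulr0 ?mul0r ?subr0 ?addr0.
Qed.

Lemma modulus_ge0 z : 0 <= modulus z.
Proof. by rewrite modulusE sqrtr_ge0. Qed.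

Lemma modulusD z w : modulus (z + w) <= modulus z + modulus w.
Proof.
by rewrite -mkscalar_le -mkscalar0D -!norm_modulus ler_normD.
Qed.

Lemma modulusM z w : modulus (z * w) = modulus z * modulus w.
Proof.
have /(congr1 (@re k)) := normrM z w.
by rewrite !norm_modulus mkscalar0M !re_mkscalar.
Qed.

Lemma modulus_eq0 z : modulus z = 0 -> z = 0.
Proof.
move=> z0; apply/normr0_eq0; rewrite norm_modulus z0.
by apply: scalarP; rewrite ?re_mkscalar ?re0 ?im0//; case: k.
Qed.

Lemma le_re_modulus z : `|re z| <= modulus z.
Proof.
by rewrite modulusE -sqrtr_sqr ler_wsqrtr// lerDl sqr_ge0.
Qed.

Lemma le_im_modulus z : `|im z| <= modulus z.
Proof.
by rewrite modulusE -sqrtr_sqr ler_wsqrtr// lerDr sqr_ge0.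
Qed.

Lemma modulus_le z : modulus z <= `|re z| + `|im z|.
Proof.
rewrite modulusE -[leRHS]ger0_norm ?addr_ge0// -sqrtr_sqr ler_wsqrtr//.
by rewrite sqrrD !real_normK ?num_real// lerD2r lerDl mulrn_wge0// mulr_ge0.
Qed.

End Scalars.

Section UnitIntervalSubstitution.
Variables (R : realType) (c : R).
Local Notation mu := (@lebesgue_measure R).

Let half (x : measurableTypeR R) : measurableTypeR R := (x + c) / 2.

Let measurable_half : measurable_fun [set: measurableTypeR R] half.
Proof. by apply: measurable_funM => //; exact: measurable_funD. Qed.

Let half_preimage (a b : R) :
  half @^-1` `]a, b] = `]2 * a - c, 2 * b - c]%classic.
Proof.
apply/seteqP; split=> x; rewrite /half/= !in_itv/= => /andP[xa xb].
  by apply/andP; split; lra.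
by apply/andP; split; lra.
Qed.

Let nu := pushforward mu half.
Let nu0 : nu set0 = 0%E. Proof. exact: measure0. Qed.
Let nu_ge0 A : (0 <= nu A)%E. Proof. exact: measure_ge0. Qed.
Let nu_sigma_additive : semi_sigma_additive nu.
Proof. exact: measure_semi_sigma_additive. Qed.

HB.instance Definition _ := isMeasure.Build _ _ _ nu
  nu0 nu_ge0 nu_sigma_additive.

Let half_ge0 : (0 <= 2^-1 :> R). Proof. by []. Qed.

Let lebesgue_half A : measurable A -> mu A = mscale (NngNum half_ge0) nu A.
Proof.
apply: lebesgue_measure_unique => // _ [[a b]] _ <-.
transitivity ((2^-1)%:E * mu (half @^-1` `]a, b]))%E; last by [].
rewrite half_preimage !lebesgue_measure_itv/= !lte_fin.
have -> : (2 * a - c < 2 * b - c) = (a < b) by apply/idP/idP; lra.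
by case: ifP => _; rewrite ?mule0// -!EFinB -EFinM; congr EFin; lra.
Qed.

Lemma integrable_half (g : R -> R) : 0 <= c <= 1 ->
  mu.-integrable `[0, 1] (EFin \o g) ->
  mu.-integrable `[0, 1] (EFin \o (fun x => g ((x + c) / 2))).
Proof.
move=> /andP[c0 c1] ig.
have /integrableP[mg] : mu.-integrable `[c / 2, (1 + c) / 2] (EFin \o g).
  apply: integrableS ig => //.
  by apply: subset_itv; rewrite bnd_simp; lra.
have preim : half @^-1` `[c / 2, (1 + c) / 2] = `[0, 1]%classic.
  apply/seteqP; split=> x; rewrite /half/= !in_itv/= => /andP[xa xb].
    by apply/andP; split; lra.
  by apply/andP; split; lra.
rewrite (eq_measure_integral (mscale (NngNum half_ge0) nu)); last first.
  by move=> A mA _; exact: lebesgue_half.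
rewrite ge0_integral_mscale//; last exact: measurableT_comp.
rewrite ge0_integral_pushforward//; last exact: measurableT_comp.
rewrite preim => ifin; apply/integrableP; split.
  apply: (measurable_comp _ _ mg) => //.
    by move=> _ [x + <-]; rewrite -preim.
  exact: measurable_funTS.
have : (2%:E * (2^-1%:E * \int[mu]_(x in `[0%R, 1%R]) `|(g (half x))%:E|) < +oo)%E.
  by rewrite lte_mul_pinfty.
by rewrite muleA -EFinM divff// mul1e.
Qed.

End UnitIntervalSubstitution.

Section IntegrableFunctions.
Variables (R : realType) (k : scalars).
Local Notation mu := (@lebesgue_measure R).
Local Notation I := (`[0%R, 1%R]%classic : set (measurableTypeR R)).
Local Notation F := (base_field R k).
Implicit Types f g : R -> F.

(* Functions on [[0, 1]] are represented by total functions on [R], of which only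
   the values on [[0, 1]] matter. Measurability is with respect to the Borel
   sets: every Lebesgue measurable function has a Borel representative, so this
   gives the same almost everywhere classes. *)
Definition integrable01 f : Prop :=
  mu.-integrable I (EFin \o (fun x => re (f x))) /\
  mu.-integrable I (EFin \o (fun x => im (f x))).

Definition integral01 f : F :=
  mkscalar k (\int[mu]_(x in I) re (f x)) (\int[mu]_(x in I) im (f x)).

Definition norm01 f : R := \int[mu]_(x in I) modulus (f x).

Definition eq01 f g : Prop := {ae mu, forall x, I x -> f x = g x}.

Lemma measurable01 : measurable I. Proof. exact: measurable_itv. Qed.

Lemma integrable01_cst (a : F) : integrable01 (fun=> a).
Proof.
have ic (r : R) : mu.-integrable I (EFin \o (fun=> r)).
  apply/integrableP; split; first exact: measurable_cst.
  rewrite integral_cst//= (_ : mu I = 1%E) ?mule1 ?ltry//.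
  by rewrite [LHS](lebesgue_measure_itv `[0%R, 1%R])/= lte_fin ltr01 oppr0 adde0.
by split; exact: ic.
Qed.

Lemma integrable01_lin (a : F) f g : integrable01 f -> integrable01 g ->
  integrable01 (fun x => a * f x + g x).
Proof.
move=> [rf imf] [rg img]; split.
  have := integrableD measurable01 (integrableB measurable01 (integrableZl measurable01 (re a) rf)
    (integrableZl measurable01 (im a) imf)) rg.
  by apply: eq_integrable => // x _ /=; rewrite reD reM.
have := integrableD measurable01 (integrableD measurable01 (integrableZl measurable01 (re a) imf)
  (integrableZl measurable01 (im a) rf)) img.
by apply: eq_integrable => // x _ /=; rewrite imD imM.
Qed.

Lemma integrable01_half f (c : R) : 0 <= c <= 1 -> integrable01 f ->
  integrable01 (fun x => f ((x + c) / 2)).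
Proof.
move=> c01 [rf imf]; split.
  exact: (@integrable_half R c (fun x => re (f x)) c01 rf).
exact: (@integrable_half R c (fun x => im (f x)) c01 imf).
Qed.

Lemma integrable01_left_half f : integrable01 f ->
  integrable01 (fun x => f (x / 2)).
Proof.
move=> /(integrable01_half (c := 0)); rewrite lexx ler01 => /(_ isT).
by under eq_fun do rewrite addr0.
Qed.

Lemma integrable01_right_half f : integrable01 f ->
  integrable01 (fun x => f ((x + 1) / 2)).
Proof. by apply: integrable01_half; rewrite lexx ler01. Qed.

Lemma integrable01_modulus f : integrable01 f ->
  mu.-integrable I (EFin \o (fun x => modulus (f x))).
Proof.
move=> [rf imf].
have /measurable_EFinP mr := measurable_int mu rf.
have /measurable_EFinP mi := measurable_int mu imf.
have isum := integrableD measurable01 (integrable_abse rf) (integrable_abse imf).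
refine (le_integrable measurable01 _ _ isum).
  apply/measurable_EFinP.
  rewrite [X in measurable_fun _ X](_ : _ = @Num.sqrt R \o
    (fun x => re (f x) ^+ 2 + im (f x) ^+ 2)); last first.
    by apply/funext => x; rewrite /= modulusE.
  apply: (measurableT_comp (continuous_measurable_fun (@sqrt_continuous R))).
  by apply: measurable_funD; exact: measurable_funX.
move=> x _ /=; rewrite lee_fin ger0_norm ?modulus_ge0//.
by rewrite (le_trans (modulus_le _))// ler_norm.
Qed.

Lemma norm01_eq0 f : integrable01 f -> norm01 f = 0 -> eq01 f (fun=> 0).
Proof.
move=> fi f0.
have mi := integrable01_modulus fi.
have f0E : (\int[mu]_(x in I) `|(modulus (f x))%:E| = 0)%E.
  under eq_integral do rewrite /= ger0_norm ?modulus_ge0//.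
  by rewrite -[LHS]fineK ?integrable_fin_num//; exact: congr1 f0.
have /(ae_eq_integral_abs mu measurable01) := f0E.
move=> /(_ (measurable_int mu mi)); apply: filterS => x /= h /h[].
exact: modulus_eq0.
Qed.

Lemma eq01_norm01 f g : integrable01 f -> integrable01 g -> eq01 f g ->
  norm01 f = norm01 g.
Proof.
move=> fi gi fg; congr fine; apply: ae_eq_integral => //.
- exact: (measurable_int mu (integrable01_modulus fi)).
- exact: (measurable_int mu (integrable01_modulus gi)).
- by apply: filterS fg => x /= h /h ->.
Qed.

Lemma eq01_integral01 f g : integrable01 f -> integrable01 g -> eq01 f g ->
  integral01 f = integral01 g.
Proof.
move=> [rf imf] [rg img] fg; congr mkscalar; congr fine; apply: ae_eq_integral.
- by [].
- exact: (measurable_int mu rf).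
- exact: (measurable_int mu rg).
- by apply: filterS fg => x /= h /h ->.
- by [].
- exact: (measurable_int mu imf).
- exact: (measurable_int mu img).
- by apply: filterS fg => x /= h /h ->.
Qed.

Lemma norm01D f g : integrable01 f -> integrable01 g ->
  norm01 (fun x => f x + g x) <= norm01 f + norm01 g.
Proof.
move=> fi gi.
have fgi : integrable01 (fun x => f x + g x).
  rewrite (_ : (fun x => f x + g x) = (fun x => 1 * f x + g x)).
    exact: integrable01_lin.
  by apply/funext => x; rewrite mul1r.
have mf := integrable01_modulus fi.
have mg := integrable01_modulus gi.
have mfg := integrable01_modulus fgi.
rewrite /norm01 -(RintegralD measurable01 mf mg).
apply: (le_Rintegral measurable01 mfg (integrableD measurable01 mf mg)).
by move=> x _; exact: modulusD.
Qed.

Lemma norm01Z (a : F) f : integrable01 f ->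
  norm01 (fun x => a * f x) = modulus a * norm01 f.
Proof.
move=> /integrable01_modulus fi; rewrite /norm01 -(RintegralZl _ measurable01 fi).
by apply: eq_Rintegral => x _; rewrite modulusM.
Qed.

End IntegrableFunctions.

Section L1.
Variables (R : realType) (k : scalars).
Local Notation mu := (@lebesgue_measure R).
Local Notation F := (base_field R k).

Definition integrable01_pred : {pred (R -> F^o)} :=
  fun f => `[< integrable01 f >].

Lemma integrable01_submod_closed : submod_closed integrable01_pred.
Proof.
split=> [|a f g /asboolP fi /asboolP gi].
  by apply/asboolP; exact: (integrable01_cst (0 : F)).
by apply/asboolP; exact: (integrable01_lin a fi gi).
Qed.

HB.instance Definition _ := GRing.isSubmodClosed.Build F (R -> F^o)
  integrable01_pred integrable01_submod_closed.

Record integrable_fun := IntegrableFun {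
  integrable_fun_val :> R -> F^o;
  _ : integrable_fun_val \in integrable01_pred }.

HB.instance Definition _ := [isSub for integrable_fun_val].
HB.instance Definition _ := [Choice of integrable_fun by <:].
HB.instance Definition _ := [SubChoice_isSubLmodule of integrable_fun by <:].

Implicit Types f g : integrable_fun.

Lemma integrable_funP f : integrable01 f.
Proof. by case: f => f /= /asboolP. Qed.

Definition to_integrable_fun (f : R -> F) (fi : integrable01 f) :
  integrable_fun := @IntegrableFun f (asboolT fi).

Definition null01_pred : {pred integrable_fun} :=
  fun f => `[< eq01 f (fun=> 0) >].

Lemma null01_submod_closed : submod_closed null01_pred.
Proof.
split=> [|a f g /asboolP f0 /asboolP g0]; apply/asboolP.
  exact: aeW.
apply: filterS2 f0 g0 => x /= f0 g0 xI.
by rewrite -[LHS]/(a *: f x + g x) f0// g0// scaler0 addr0.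
Qed.

HB.instance Definition _ := GRing.isSubmodClosed.Build F integrable_fun
  null01_pred null01_submod_closed.

(* [L^1[0,1]]: integrable functions modulo equality almost everywhere on
   [[0, 1]]. *)
Definition L1 := Quotient.quot null01_pred.

HB.instance Definition _ := GRing.Zmodule.on L1.
HB.instance Definition _ := EqQuotient.on L1.

Definition L1_class (f : integrable_fun) : L1 := \pi_L1%qT f.

Lemma L1_classP f g : L1_class f = L1_class g <-> eq01 f g.
Proof.
rewrite /L1_class; split=> [/eqP|fg].
  rewrite -Quotient.idealrBE => /asboolP; apply: filterS => x /= h /h.
  by rewrite -[LHS]/(f x - g x) => /subr0_eq.
apply/eqP; rewrite -Quotient.idealrBE; apply/asboolP.
apply: filterS fg => x /= h /h fgx.
by rewrite -[LHS]/(f x - g x) fgx subrr.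
Qed.

Lemma L1_reprK (u : L1) : L1_class (repr u) = u. Proof. exact: reprK. Qed.

Lemma eq01_repr f : eq01 (repr (L1_class f)) f.
Proof. by apply/L1_classP; rewrite L1_reprK. Qed.

Definition L1_scale (a : F) (u : L1) : L1 := L1_class (a *: repr u).

Lemma L1_classD f g : L1_class (f + g) = L1_class f + L1_class g.
Proof. by rewrite /L1_class !piE. Qed.

Lemma L1_classZ_subproof a f : L1_scale a (L1_class f) = L1_class (a *: f).
Proof.
apply/L1_classP; apply: filterS (eq01_repr f) => x /= h /h fx.
by rewrite -[LHS]/(a *: repr (L1_class f) x) fx.
Qed.

Lemma L1_scaleA a b u : L1_scale a (L1_scale b u) = L1_scale (a * b) u.
Proof.
by rewrite -(L1_reprK u) !L1_classZ_subproof scalerA.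
Qed.
Lemma L1_scale1 : left_id 1 L1_scale.
Proof. by move=> u; rewrite -(L1_reprK u) !L1_classZ_subproof scale1r. Qed.
Lemma L1_scaleDr : right_distributive L1_scale +%R.
Proof.
move=> a u v; rewrite -(L1_reprK u) -(L1_reprK v) -L1_classD.
by rewrite !L1_classZ_subproof scalerDr L1_classD.
Qed.
Lemma L1_scaleDl u : {morph L1_scale^~ u : a b / a + b}.
Proof.
by move=> a b; rewrite -(L1_reprK u) !L1_classZ_subproof scalerDl L1_classD.
Qed.

HB.instance Definition _ := GRing.Zmodule_isLmodule.Build F L1
  L1_scaleA L1_scale1 L1_scaleDr L1_scaleDl.

Lemma L1_classZ a f : L1_class (a *: f) = a *: L1_class f.
Proof. by rewrite -L1_classZ_subproof. Qed.

Definition L1_norm (u : L1) : F := mkscalar k (norm01 (repr u)) 0.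

Lemma L1_normE f : L1_norm (L1_class f) = mkscalar k (norm01 f) 0.
Proof.
congr mkscalar; apply: eq01_norm01 (eq01_repr f); exact: integrable_funP.
Qed.

Lemma L1_normD u v : L1_norm (u + v) <= L1_norm u + L1_norm v.
Proof.
rewrite -(L1_reprK u) -(L1_reprK v) -L1_classD !L1_normE mkscalar0D mkscalar_le.
by apply: norm01D; exact: integrable_funP.
Qed.

Lemma L1_normZ (a : F) u : L1_norm (a *: u) = `|a| * L1_norm u.
Proof.
rewrite -(L1_reprK u) -L1_classZ !L1_normE norm_modulus mkscalar0M.
by congr mkscalar; apply: norm01Z; exact: integrable_funP.
Qed.

Lemma L1_norm_eq0 u : L1_norm u = 0 -> u = 0.
Proof.
rewrite -(L1_reprK u) L1_normE => /(congr1 (@re R k)).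
rewrite re_mkscalar re0 => /norm01_eq0 => /(_ (integrable_funP _)) u0.
transitivity (L1_class 0); last by rewrite /L1_class !piE.
by apply/L1_classP.
Qed.

HB.instance Definition _ := Lmodule_isNormed.Build F L1
  L1_normD L1_normZ L1_norm_eq0.

Lemma L1_class_norm f : `|L1_class f| = mkscalar k (norm01 f) 0.
Proof. exact: L1_normE. Qed.

Definition L1_integral (u : L1) : F := integral01 (repr u).

Lemma L1_integral_class f : L1_integral (L1_class f) = integral01 f.
Proof. by apply: eq01_integral01 (eq01_repr f); exact: integrable_funP. Qed.

Definition L1_one : L1 :=
  L1_class (to_integrable_fun (integrable01_cst (1 : F))).

Definition left_half f : integrable_fun :=
  to_integrable_fun (integrable01_left_half (integrable_funP f)).

Definition right_half f : integrable_fun :=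
  to_integrable_fun (integrable01_right_half (integrable_funP f)).

(* [M] lies in the base field, where the norms take their values; over [R[i]] the
   inequality at a nonzero [u] forces [M] to be real. *)
Definition bounded_linear_functional (Phi : L1 -> F) : Prop :=
  linear (Phi : L1 -> F^o) /\ exists M : F, forall u, `|Phi u| <= M * `|u|.

Definition halving_invariant (Phi : L1 -> F) : Prop :=
  forall f, Phi (L1_class f) =
    2^-1 * (Phi (L1_class (left_half f)) + Phi (L1_class (right_half f))).

End L1.

(* Main.v *)
(* Let D be the difference of two functionals with the stated properties; it is
   bounded, satisfies the halving identity, and kills the constants. Write r_a for
   the indicator of ]-oo, a]. On [0, 1] the two halves of r_a are r_(2a) and
   r_(2a - 1), of which at least one is constant there, so D r_a = D r_b / 2 for
   some b. Iterating, |D r_a| <= ||D|| / 2^n for every n, hence D r_a = 0. By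
   Dynkin's pi-lambda theorem D vanishes on the indicators of all Borel sets, and
   by density of the simple functions D = 0. *)
Require Import Defs.
From HB Require Import structures.
From mathcomp Require Import all_boot all_order all_algebra.
From mathcomp Require Import all_classical all_reals all_analysis.
From mathcomp Require Import measurable_realfun complex lra ring.

Set Implicit Arguments.
Unset Strict Implicit.
Unset Printing Implicit Defensive.

Import Order.TTheory GRing.Theory Num.Theory.
Import numFieldNormedType.Exports.

Local Open Scope classical_set_scope.
Local Open Scope ring_scope.

(** * Change of variables by x |-> (x + c) / 2 *)

Section HalfUnitInterval.
Variables (R : realType) (c : R).
Local Notation mu := (@lebesgue_measure R).
Local Notation I := (`[0%R, 1%R]%classic : set (measurableTypeR R)).
Local Notation half_itv :=
  (`[c / 2, (1 + c) / 2]%classic : set (measurableTypeR R)).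

Let half (x : measurableTypeR R) : measurableTypeR R := (x + c) / 2.

Let measurable_half : measurable_fun [set: measurableTypeR R] half.
Proof. by apply: measurable_funM => //; exact: measurable_funD. Qed.

Let nu := pushforward mu half.
Let nu0 : nu set0 = 0%E. Proof. exact: measure0. Qed.
Let nu_ge0 A : (0 <= nu A)%E. Proof. exact: measure_ge0. Qed.
Let nu_sigma_additive : semi_sigma_additive nu.
Proof. exact: measure_semi_sigma_additive. Qed.

HB.instance Definition _ := isMeasure.Build _ _ _ nu
  nu0 nu_ge0 nu_sigma_additive.

Let half_ge0 : (0 <= 2^-1 :> R). Proof. by []. Qed.

(** The preimage of []a, b]] under [half] is an interval twice as long, and Lebesgue measure is
    determined by its values on half-open intervals. *)
Let lebesgue_half A : measurable A -> mu A = mscale (NngNum half_ge0) nu A.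
Proof.
apply: lebesgue_measure_unique => // _ [[a b]] _ <-.
transitivity ((2^-1)%:E * mu (half @^-1` `]a, b]))%E; last by [].
have -> : half @^-1` `]a, b] = `]2 * a - c, 2 * b - c]%classic.
  apply/seteqP; split=> x; rewrite /half/= !in_itv/= => /andP[xa xb];
  by apply/andP; split; lra.
rewrite !lebesgue_measure_itv/= !lte_fin.
have -> : (2 * a - c < 2 * b - c) = (a < b) by apply/idP/idP; lra.
by case: ifP => _; rewrite ?mule0// -!EFinB -EFinM; congr EFin; lra.
Qed.

(** Replacing [mu] by the halved image measure moves the integral to the preimage of the interval
    under [half], which is [0, 1]. Values in the extended reals make this applicable to positive and
    negative parts. *)
Lemma ge0_integral_half (f : R -> \bar R) :
  measurable_fun half_itv f -> (forall x, 0 <= f x)%E ->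
  (\int[mu]_(x in half_itv) f x =
   2^-1%:E * \int[mu]_(x in `[0%R, 1%R]) f ((x + c) / 2)%R)%E.
Proof.
move=> mf f0; rewrite (eq_measure_integral (mscale (NngNum half_ge0) nu)); last first.
  by move=> A mA _; exact: lebesgue_half.
rewrite ge0_integral_mscale// ge0_integral_pushforward//.
rewrite (_ : half @^-1` _ = `[0, 1]%classic)//.
apply/seteqP; split=> x; rewrite /half/= !in_itv/= => /andP[xa xb];
by apply/andP; split; lra.
Qed.

Lemma Rintegral_half (g : R -> R) :
  mu.-integrable half_itv (EFin \o g) ->
  mu.-integrable `[0, 1] (EFin \o (fun x => g ((x + c) / 2))) ->
  \int[mu]_(x in `[0, 1]) g ((x + c) / 2) = 2 * \int[mu]_(x in half_itv) g x.
Proof.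
move=> ig ih; have mg := measurable_int mu ig; rewrite /Rintegral.
(* Both parts must have finite integrals, since [fine] respects differences only at finite values;
   this rules out the infinite cases below. *)
have Pfin := integrable_fin_num (@measurable01 R)
  (integrable_funepos (@measurable01 R) ih).
have Nfin := integrable_fin_num (@measurable01 R)
  (integrable_funeneg (@measurable01 R) ih).
rewrite [in LHS]integralE [in RHS]integralE.
rewrite !ge0_integral_half//; [|exact: measurable_funeneg|exact: measurable_funepos].
rewrite (funepos_comp (EFin \o g) half) in Pfin *.
rewrite (funeneg_comp (EFin \o g) half) in Nfin *.
move: Pfin Nfin; rewrite /comp/half.
set P := (\int[mu]_(x in I) _ ((x + c) / 2)%R)%E.
set N := (\int[mu]_(x in I) _ ((x + c) / 2)%R)%E.
move: P N => [p||] [n||] //= _ _.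
by rewrite -mulrBr mulrA divff// mul1r.
Qed.

End HalfUnitInterval.

(** The substitution with c = 0 and c = 1 turns the right side into the sum of the integrals over
    [0, 1/2] and [1/2, 1]. *)
Lemma Rintegral01_halving (R : realType) (g : R -> R) :
  lebesgue_measure.-integrable `[0, 1] (EFin \o g) ->
  \int[lebesgue_measure]_(x in `[0, 1]) g x =
  2^-1 * (\int[lebesgue_measure]_(x in `[0, 1]) g (x / 2) +
          \int[lebesgue_measure]_(x in `[0, 1]) g ((x + 1) / 2)).
Proof.
move=> ig.
have sub (a b : R) : 0 <= a -> b <= 1 ->
    lebesgue_measure.-integrable `[a, b] (EFin \o g).
  by move=> a0 b1; apply: integrableS ig => //; apply: subset_itv; rewrite bnd_simp.
have e0 : (fun x => g (x / 2)) = (fun x => g ((x + 0) / 2)).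
  by apply/funext => x; rewrite addr0.
rewrite [X in _ = _ * (Rintegral _ _ X + _)]e0 !Rintegral_half.
2,4: by apply: sub; lra.
2,3: by apply: integrable_half => //; rewrite ?lexx ?ler01.
rewrite -mulrDr mulrA mulVf// !mul1r mul0r addr0 div1r (_ : (1 + 1) / 2 = 1); last by lra.
(* Cutting [0, 1] at 1/2 leaves an interval open at 1/2; its integral equals that over the closed
   one because a point is null. *)
have ih : lebesgue_measure.-integrable `]2^-1, 1] (EFin \o g).
  by apply: integrableS ig => //; apply: subset_itv; rewrite bnd_simp//; lra.
have /= := @Rintegral_itvB R g (BLeft 0) (BRight 1) 2^-1 ig.
rewrite !bnd_simp (Rintegral_itv_obnd_cbnd ih) => <-; [by ring|lra|lra].
Qed.

Lemma lebesgue_measure01 (R : realType) :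
  @lebesgue_measure R (`[0%R, 1%R]%classic : set (measurableTypeR R)) = 1%E.
Proof.
by rewrite [LHS](lebesgue_measure_itv `[0%R, 1%R])/= lte_fin ltr01 oppr0 adde0.
Qed.

Import HBSimple.

(** * Vanishing of real functionals that satisfy the halving identity and kill 1 *)

Section HalvingFunctional.
Variables (R : realType) (E : (R -> R) -> R) (M : R).
Local Notation mu := (@lebesgue_measure R).
Local Notation I := (`[0%R, 1%R]%classic : set (measurableTypeR R)).
Local Notation itg f := (mu.-integrable I (EFin \o f)).

Hypothesis E_lin : forall a f g, itg f -> itg g ->
  E (fun x => a * f x + g x) = a * E f + E g.
Hypothesis E_bound : forall f, itg f ->
  `|E f| <= M * \int[mu]_(x in I) `|f x|.
Hypothesis E_halving : forall f, itg f ->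
  E f = 2^-1 * (E (fun x => f (x / 2)) + E (fun x => f ((x + 1) / 2))).
Hypothesis E1 : E (cst 1) = 0.

Let itg_cst (a : R) : itg (cst a).
Proof. exact: (integrable01_cst (k := RealScalars) a).1. Qed.

Let mu01I_le1 (A : set (measurableTypeR R)) : measurable A ->
  (mu (A `&` I) <= 1)%E.
Proof.
move=> mA; rewrite -(lebesgue_measure01 R); apply: le_measure; rewrite ?inE//.
exact: measurableI.
Qed.

Let itg_indic (A : set (measurableTypeR R)) : measurable A -> itg \1_A.
Proof.
move=> mA; apply: (le_integrable (@measurable01 R) _ _ (itg_cst 1)).
  exact/measurable_EFinP.
by move=> x _ /=; rewrite lee_fin normr1 ger0_norm// indicE; case: (_ \in _).
Qed.

Let itg_lin a f g : itg f -> itg g -> itg (fun x => a * f x + g x).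
Proof.
move=> fi gi.
exact: (integrableD (@measurable01 R) (integrableZl (@measurable01 R) a fi) gi).
Qed.

(** [E] acts on total functions, but the bound applied to g - f, whose integral norm over [0, 1] is
    0, makes it blind to values outside [0, 1]. *)
Let E_eq f g : itg f -> itg g -> (forall x, I x -> f x = g x) -> E f = E g.
Proof.
move=> fi gi fg; apply/eqP; rewrite -subr_eq0 addrC -mulN1r -E_lin//.
rewrite -normr_le0 (le_trans (E_bound _))//; first exact: itg_lin.
rewrite (@eq_Rintegral _ _ _ _ _ (cst 0)).
  by rewrite (Rintegral_cst mu (@measurable01 R)) mul0r mulr0.
by move=> x /set_mem /fg ->; rewrite mulN1r addNr normr0.
Qed.

Let E0 : E (cst 0) = 0.
Proof.
rewrite (_ : cst 0 = (fun x => (-1) * cst 1 x + cst 1 x)) ?E_lin ?E1 ?mulr0 ?addr0//.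
by apply/funext => x /=; rewrite mulr1 addNr.
Qed.

(** This makes [E] small on sets of small measure. The absolute value of [M] appears because [M]
    carries no sign assumption. *)
Let E_indic_le (A : set (measurableTypeR R)) : measurable A ->
  `|E \1_A| <= `|M| * fine (mu (A `&` I)).
Proof.
move=> mA; rewrite (le_trans (E_bound (itg_indic mA)))//.
rewrite (@le_trans _ _ (`|M| * \int[mu]_(x in I) `|\1_A x|))//.
  by rewrite ler_wpM2r ?ler_norm// Rintegral_ge0.
rewrite ler_wpM2l// le_eqVlt; apply/orP; left; apply/eqP; congr fine.
rewrite -(integral_indic mu (@measurable01 R) mA).
by apply: eq_integral => x _; rewrite ger0_norm// indicE.
Qed.

Let E_ray_le n a : `|E \1_(`]-oo, a])| <= `|M| / 2 ^+ n.
Proof.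
have mray (b : R) : measurable (`]-oo, b] : set (measurableTypeR R)).
  exact: measurable_itv.
elim: n a => [|n IH] a.
  rewrite expr0 divr1 (le_trans (E_indic_le _))// -[leRHS]mulr1 ler_wpM2l//.
  by rewrite -lee_fin fineK ?mu01I_le1// ge0_fin_numE// (le_lt_trans (mu01I_le1 _))// ltry.
rewrite E_halving; last exact: itg_indic.
have -> : (fun x => \1_(`]-oo, a]) (x / 2)) = \1_(`]-oo, 2 * a]) :> (R -> R).
  apply/funext => x; rewrite !indicE; congr (nat_of_bool _)%:R.
  by apply/idP/idP; rewrite !inE/= !in_itv/=; lra.
have -> : (fun x => \1_(`]-oo, a]) ((x + 1) / 2)) = \1_(`]-oo, 2 * a - 1]) :> (R -> R).
  apply/funext => x; rewrite !indicE; congr (nat_of_bool _)%:R.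
  by apply/idP/idP; rewrite !inE/= !in_itv/=; lra.
have [b ->] : exists b, E \1_(`]-oo, 2 * a]) + E \1_(`]-oo, 2 * a - 1]) =
    E \1_(`]-oo, b]).
  (* If a < 1/2, the ray up to 2a - 1 misses [0, 1] and contributes [E] of 0. Otherwise the ray up
     to 2a contains [0, 1] and contributes [E] of 1. Either way one term is 0. *)
  have [a2|a2] := ltP a 2^-1.
    exists (2 * a); rewrite [X in _ + X](_ : _ = 0) ?addr0// -E0.
    apply: E_eq => // [|x]; first exact: itg_indic.
    rewrite /= in_itv/= => /andP[x0 x1]; rewrite indicE memNset//= in_itv/=.
    by apply/negP; rewrite -ltNge; lra.
  exists (2 * a - 1); rewrite [X in X + _](_ : _ = 0) ?add0r// -E1.
  apply: E_eq => // [|x]; first exact: itg_indic.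
  rewrite /= in_itv/= => /andP[x0 x1]; rewrite indicE mem_set//= in_itv/=.
  by lra.
by rewrite normrM ger0_norm// exprS invfM mulrCA ler_wpM2l.
Qed.

Let E_ray a : E \1_(`]-oo, a]) = 0.
Proof.
apply/eqP; rewrite -normr_le0.
have h : (fun n => `|M| / 2 ^+ n) @ \oo --> (0 : R).
  rewrite (_ : (fun n => _) = geometric `|M| 2^-1); last first.
    by apply/funext => n; rewrite /geometric/= exprVn.
  by apply: cvg_geometric; rewrite ger0_norm// invf_lt1// ltr1n.
apply: (ler_cvg_to (cvg_cst _) h).
by apply: nearW => n; exact: E_ray_le.
Qed.

Let E_indic : forall A : set (measurableTypeR R), measurable A -> E \1_A = 0.
Proof.
(* Proper differences serve three times below: half-open intervals from rays, complements, and the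
   peeling of one set off a union. *)
have indicB (A B : set (measurableTypeR R)) : measurable A -> measurable B ->
    A `<=` B -> E \1_(B `\` A) = E \1_B - E \1_A.
  move=> mA mB AB; rewrite addrC -mulN1r -E_lin; [|exact: itg_indic..].
  congr E; apply/funext => x; rewrite !indicE in_setD.
  case: (boolP (x \in A)) => xA; last by rewrite mulr0 add0r andbT.
  by rewrite mulr1 andbF (_ : x \in B) ?addNr//; apply/mem_set/AB/set_mem.
apply: (@dynkin_induction _ (measurableTypeR R) (@ocitv R) (fun A => E \1_A = 0)) => //.
- exact: ocitvI.
- by rewrite indicT.
- move=> _ [[a b] _ <-] /=; have [ab|ba] := leP a b; last first.
    by rewrite set_itv_ge ?indic0// bnd_simp -leNgt ltW.
  rewrite (_ : `]a, b]%classic = `]-oo, b] `\` `]-oo, a]); last first.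
    apply/seteqP; split=> x /=; rewrite !in_itv/=.
      by move=> /andP[ax ->]; split=> //; apply/negP; rewrite -ltNge.
    by move=> [-> /negP]; rewrite -ltNge => ->.
  rewrite indicB ?E_ray ?subr0//; try exact: measurable_itv.
  by apply: subset_itvl; rewrite bnd_simp.
- by move=> S mS S0; rewrite -setTD indicB// indicT E1 S0 subr0.
(* Linearity gives only finite additivity, so a countable union is handled through its tails [A n].
   Removing [F n] from [A n] leaves the value of [E] unchanged, and continuity from above sends the
   measures of the tails to 0. *)
- move=> F mF tF F0; pose A n := \bigcup_(k >= n) F k.
  have mA n : measurable (A n) by exact: bigcup_measurable.
  have EA n : E \1_(A 0%N) = E \1_(A n).
    elim: n => // n ->; have -> : A n.+1 = A n `\` F n.
      apply/seteqP; split=> [x [k nk Fkx]|x [[k /= nk Fkx] Fnx]].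
        split; first by exists k => //=; exact: ltnW.
        by move=> Fnx; move: nk; rewrite /= (tF n k) ?ltnn//; exists x.
      exists k => //=; rewrite ltn_neqAle nk andbT.
      by apply/eqP => nk'; apply: Fnx; rewrite nk'.
    by rewrite indicB ?F0 ?subr0// => x Fx; exists n => /=.
  rewrite -[X in \1_X]/(bigcup setT F) (_ : bigcup setT F = A 0%N); last first.
    by apply/seteqP; split=> x [k _ Fx]; exists k.
  apply/eqP; rewrite -normr_le0.
  (* Intersecting with [0, 1] supplies the finite measure that continuity from above requires. *)
  have AI : mu \o (fun n => A n `&` I) @ \oo --> mu (\bigcap_n (A n `&` I)).
    apply: nonincreasing_cvg_mu => //.
    + by rewrite /= (le_lt_trans (mu01I_le1 _)) ?ltry//.
    + by move=> n; exact: measurableI.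
    + by apply: bigcapT_measurable => n; exact: measurableI.
    + move=> m n mn; apply/subsetPset; apply: setSI => x [k /= nk Fx].
      by exists k => //=; exact: leq_trans nk.
  (* By disjointness, a point of [F k] lies in no later set, hence not in [A k.+1]. *)
  have AI0 : \bigcap_n (A n `&` I) = set0.
    rewrite -subset0 => x Ax; have [[k _ Fkx] _] := Ax 0%N Logic.I.
    have [[j /= kj Fjx] _] := Ax k.+1 Logic.I.
    by move: kj; rewrite (tF k j) ?ltnn//; exists x.
  rewrite AI0 measure0 in AI.
  have h : (fun n => `|M| * fine (mu (A n `&` I))) @ \oo --> `|M| * 0.
    by apply: cvgMr; exact: (fine_cvg AI).
  rewrite mulr0 in h; apply: (ler_cvg_to (cvg_cst _) h).
  by apply: nearW => n; rewrite (EA n); exact: E_indic_le.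
Qed.

Let E_sfun (g : {sfun (measurableTypeR R) >-> R}) : E g = 0.
Proof.
(* Integrability is carried through the induction because [E_lin] demands it of each partial sum. *)
have E_sum n (c : nat -> R) (A : nat -> set (measurableTypeR R)) :
    (forall i, measurable (A i)) ->
    itg (fun x => \sum_(i < n) (c i * \1_(A i) x)) /\
    E (fun x => \sum_(i < n) (c i * \1_(A i) x)) = 0.
  move=> mA; elim: n => [|n [IHi IH]].
    rewrite (_ : (fun=> _) = cst 0); first by rewrite E0; split; [exact: itg_cst|].
    by apply/funext => x; rewrite big_ord0.
  rewrite (_ : (fun=> _) = (fun x => c n * \1_(A n) x +
    \sum_(i < n) (c i * \1_(A i) x))); last first.
    by apply/funext => x; rewrite big_ord_recr/= addrC.
  split; first by apply: itg_lin => //; exact: itg_indic.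
  rewrite E_lin//; last exact: itg_indic.
  by rewrite IH E_indic// mulr0 addr0.
pose s := finmap.enum_fset (fset_set (range g)).
have [_ /=] := E_sum (size s) (nth 0 s) (fun i => g @^-1` [set s`_i])
  (fun i => measurable_sfunP g (measurable_set1 _)).
by congr (E _ = 0); apply/funext => x; rewrite [RHS]fimfunEord.
Qed.

(** For simple functions g_n converging to f in L^1, [E] takes the same value at f and at f - g_n,
    and the latter is bounded by a multiple of the distance from f to g_n. *)
Lemma halving_functional_eq0 f : itg f -> E f = 0.
Proof.
move=> fi; have [g [gi _ g0]] := approximation_sfun_integrable (@measurable01 R) fi.
apply/eqP; rewrite -normr_le0.
suff: (`|E f|%:E <= 0)%E by rewrite lee_fin.
have h : (fun n => `|M|%:E * \int[mu]_(x in I) `|(f x)%:E - (g n x)%:E|)%E @ \oo --> 0%E.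
  by rewrite -[X in _ --> X](mule0 `|M|%:E); exact: cvgeZl.
rewrite -(cvg_lim _ h)//; apply: lime_ge; first by apply/cvg_ex; exists 0%E.
apply: nearW => n; have {}gi := gi n.
have gfi := itg_lin (-1) gi fi.
have -> : E f = E (fun x => -1 * g n x + f x).
  by rewrite E_lin// E_sfun mulr0 add0r.
have -> : (\int[mu]_(x in I) `|(f x)%:E - (g n x)%:E| =
    (\int[mu]_(x in I) `|-1 * g n x + f x|)%:E)%E.
  rewrite fineK; last first.
    exact: (integrable_fin_num (@measurable01 R) (integrable_abse gfi)).
  by apply: eq_integral => x _; rewrite -EFinB /= mulN1r addrC.
rewrite -EFinM lee_fin (le_trans (E_bound gfi))// ler_wpM2r ?ler_norm//.
exact: Rintegral_ge0.
Qed.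

End HalvingFunctional.

(** * Real and imaginary parts, uniformly in the base field *)

Section ScalarParts.
Variables (R : realType) (k : scalars).
Implicit Types z w : base_field R k.

Lemma im_mkscalar0 (a : R) : im (mkscalar k a 0) = 0.
Proof. by case: k. Qed.

Lemma modulus_mkscalar0 (a : R) : modulus (mkscalar k a 0) = `|a|.
Proof. by rewrite modulusE re_mkscalar im_mkscalar0 expr0n addr0 sqrtr_sqr. Qed.

Lemma re_le z w : z <= w -> re z <= re w.
Proof. by case: k z w => // z w; rewrite lecE => /andP[]. Qed.

Lemma half_mkscalar : 2^-1 = mkscalar k 2^-1 0 :> base_field R k.
Proof.
have two_mk : 2 = mkscalar k 2 0 :> base_field R k.
  by rewrite -[2]/(1 + 1) -mkscalar0D; case: k.
have two_neq0 : 2 != 0 :> base_field R k by rewrite pnatr_eq0.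
apply: (mulfI two_neq0); rewrite mulfV// two_mk mkscalar0M mulfV//.
by case: k.
Qed.

(** Over the reals the stand-in [mkscalar k 0 1] for i is 0, so the first term disappears and one
    identity covers both fields. *)
Lemma scalar_re_im z :
  z = mkscalar k 0 1 * mkscalar k (im z) 0 + mkscalar k (re z) 0.
Proof.
case: k z => /= [z|[a b]]; first by rewrite mul0r add0r.
by apply/eqP; rewrite eq_complex/=; apply/andP; split; apply/eqP; ring.
Qed.

End ScalarParts.

(** * The integral has the stated properties *)

Section Integral.
Variables (R : realType) (k : scalars).
Local Notation mu := (@lebesgue_measure R).
Local Notation I := (`[0%R, 1%R]%classic : set (measurableTypeR R)).
Local Notation F := (base_field R k).
Implicit Types f g : R -> F.

Lemma re_integral01 f : re (integral01 f) = \int[mu]_(x in I) re (f x).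
Proof. exact: re_mkscalar. Qed.

Lemma im_integral01 f : im (integral01 f) = \int[mu]_(x in I) im (f x).
Proof.
rewrite /integral01; case: k f => //= f.
by rewrite (Rintegral_cst mu (@measurable01 R)) mul0r.
Qed.

Lemma integral01_lin (a : F) f g : integrable01 f -> integrable01 g ->
  integral01 (fun x => a * f x + g x) = a * integral01 f + integral01 g.
Proof.
have m01 := @measurable01 R.
move=> [rf imf] [rg img]; apply: Defs.scalarP.
  rewrite reD reM !re_integral01 im_integral01.
  rewrite -(RintegralZl _ m01 rf) -(RintegralZl _ m01 imf).
  have irf := integrableZl m01 (re a) rf.
  have iif := integrableZl m01 (im a) imf.
  rewrite -(RintegralB m01 irf iif) -(RintegralD m01 (integrableB m01 irf iif) rg).
  by apply: eq_Rintegral => x _; rewrite reD reM.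
rewrite imD imM !im_integral01 re_integral01.
rewrite -(RintegralZl _ m01 rf) -(RintegralZl _ m01 imf).
have irf := integrableZl m01 (im a) rf.
have iif := integrableZl m01 (re a) imf.
rewrite -(RintegralD m01 iif irf) -(RintegralD m01 (integrableD m01 iif irf) img).
by apply: eq_Rintegral => x _; rewrite imD imM.
Qed.

(** The factor 2 comes from bounding the real and the imaginary part separately, each by the
    norm. *)
Lemma modulus_integral01 f : integrable01 f ->
  modulus (integral01 f) <= 2 * norm01 f.
Proof.
move=> fi; have m01 := @measurable01 R; have mf := integrable01_modulus fi.
case: fi => rf imf; rewrite (le_trans (modulus_le _))//.
rewrite re_integral01 im_integral01 mulr_natl mulr2n lerD//.
  rewrite (le_trans (le_normr_Rintegral m01 rf))//.
  apply: le_Rintegral (integrable_abse rf) mf _ => // x _.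
  exact: le_re_modulus.
rewrite (le_trans (le_normr_Rintegral m01 imf))//.
apply: le_Rintegral (integrable_abse imf) mf _ => // x _.
exact: le_im_modulus.
Qed.

Lemma bounded_linear_L1_integral : bounded_linear_functional (@L1_integral R k).
Proof.
split=> [a u v|].
  rewrite -(L1_reprK u) -(L1_reprK v) -L1_classZ -L1_classD !L1_integral_class.
  exact: (integral01_lin a (integrable_funP (repr u)) (integrable_funP (repr v))).
exists (mkscalar k 2 0) => u.
rewrite -(L1_reprK u) L1_integral_class L1_class_norm norm_modulus mkscalar0M.
by rewrite mkscalar_le modulus_integral01//; exact: integrable_funP.
Qed.

Lemma L1_integral_one : L1_integral (L1_one R k) = 1.
Proof.
have mu01 : fine (mu I) = 1 by rewrite lebesgue_measure01.
rewrite L1_integral_class; apply: Defs.scalarP.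
  rewrite re_integral01 -[LHS]/(\int[mu]_(x in I) re (1 : F)).
  by rewrite (Rintegral_cst mu (@measurable01 R)) mu01 mulr1.
rewrite im_integral01 -[LHS]/(\int[mu]_(x in I) im (1 : F)).
by rewrite (Rintegral_cst mu (@measurable01 R)) mu01 mulr1.
Qed.

Lemma halving_invariant_L1_integral : halving_invariant (@L1_integral R k).
Proof.
move=> f; rewrite !L1_integral_class half_mkscalar.
have [rf imf] := integrable_funP f.
apply: Defs.scalarP.
  rewrite reM reD im_mkscalar0 mul0r subr0 re_mkscalar !re_integral01.
  exact: Rintegral01_halving rf.
rewrite imM imD im_mkscalar0 mul0r addr0 re_mkscalar !im_integral01.
exact: Rintegral01_halving imf.
Qed.

End Integral.

(** * Reduction of uniqueness to real functionals of real functions *)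

Section Uniqueness.
Variables (R : realType) (k : scalars).
Local Notation mu := (@lebesgue_measure R).
Local Notation I := (`[0%R, 1%R]%classic : set (measurableTypeR R)).
Local Notation F := (base_field R k).
Variable D : L1 R k -> F.
Hypothesis D_blf : bounded_linear_functional D.
Hypothesis D_halving : halving_invariant D.
Hypothesis D_one : D (L1_one R k) = 0.

Let lift (g : R -> R) : R -> F := fun x => mkscalar k (g x) 0.

(* [insubd] sends the non-integrable functions to [0], so that [E] can be applied
   to all functions. *)
Let E (g : R -> R) : F := D (L1_class (insubd (0 : integrable_fun R k) (lift g))).

Let lift_integrable (g : R -> R) :
  mu.-integrable I (EFin \o g) -> integrable01 (lift g).
Proof.
move=> gi; split.
  rewrite (_ : (fun x => re (lift g x)) = g)//.
  by apply/funext => x; exact: re_mkscalar.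
rewrite (_ : (fun x => im (lift g x)) = cst 0).
  exact: (integrable01_cst (k := RealScalars) (0 : R)).1.
by apply/funext => x; exact: im_mkscalar0.
Qed.

(** This eliminates [insubd]: at an integrable g the default value is never taken, and any packaging
    of [lift g] may be used. *)
Let ED (g : R -> R) (h : integrable_fun R k) :
  mu.-integrable I (EFin \o g) -> (h : R -> F) = lift g -> E g = D (L1_class h).
Proof.
move=> gi hg; congr (D (L1_class _)); apply: val_inj.
rewrite insubdK; first exact: esym.
by apply/asboolP; exact: lift_integrable.
Qed.

(** [T] stands for [re] or [im]. Real linearity and the bound by the modulus are what pass the
    properties of [D] to the real functional [T \o E]. *)
Let part_eq0 (T : F -> R) (g : R -> R) :
  (forall z w, T (z + w) = T z + T w) ->
  (forall a z, T (mkscalar k a 0 * z) = a * T z) ->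
  (forall z, `|T z| <= modulus z) ->
  mu.-integrable I (EFin \o g) -> T (E g) = 0.
Proof.
move=> TD TZ Tle; have [D_lin [M D_le]] := D_blf.
apply: (halving_functional_eq0 (E := T \o E) (M := re M)) => [a f h fi hi|f fi|f fi|] /=.
- pose F1 := to_integrable_fun (lift_integrable fi).
  pose H1 := to_integrable_fun (lift_integrable hi).
  rewrite (@ED f F1)// (@ED h H1)// (@ED _ (mkscalar k a 0 *: F1 + H1)).
  + by rewrite L1_classD L1_classZ D_lin TD TZ.
  + exact: (integrableD (@measurable01 R) (integrableZl (@measurable01 R) a fi) hi).
  + by apply/funext => x; rewrite /lift -mkscalar0D -mkscalar0M.
- pose F1 := to_integrable_fun (lift_integrable fi).
  rewrite (@ED f F1)// (le_trans (Tle _))//.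
  (* The constant [M] lies in the base field. As the norm of the class has zero imaginary part,
     taking real parts leaves [re M] as a real bound. *)
  have /re_le := D_le (L1_class F1).
  rewrite L1_class_norm reM im_mkscalar0 mulr0 subr0 re_mkscalar.
  rewrite /norm01 (@eq_Rintegral _ _ _ _ _ (fun x => `|f x|))//.
  by move=> x _; rewrite /= /lift modulus_mkscalar0.
- pose F1 := to_integrable_fun (lift_integrable fi).
  rewrite (@ED f F1)// D_halving half_mkscalar TZ TD.
  rewrite (@ED _ (left_half F1)) ?(@ED _ (right_half F1))//.
  + by apply: integrable_half => //; rewrite lexx ler01.
  + rewrite (_ : (fun x => f (x / 2)) = (fun x => f ((x + 0) / 2))).
      by apply: integrable_half => //; rewrite lexx ler01.
    by apply/funext => x; rewrite addr0.
- rewrite (@ED _ (to_integrable_fun (integrable01_cst (1 : F)))).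
  (* Homogeneity at the scalar 0 gives T 0 = 0. *)
  + by rewrite [D _]D_one; have := TZ 0 0; rewrite mulr0 mul0r.
  + exact: (integrable01_cst (k := RealScalars) (1 : R)).1.
  + by apply/funext => x; rewrite /lift/=; case: k.
Qed.

Let E_eq0 (g : R -> R) : mu.-integrable I (EFin \o g) -> E g = 0.
Proof.
move=> gi; apply: Defs.scalarP; rewrite ?re0 ?im0.
  apply: (part_eq0 (T := @re R k)) gi => [z w|a z|z].
  - exact: reD.
  - by rewrite reM re_mkscalar im_mkscalar0 mul0r subr0.
  - exact: le_re_modulus.
apply: (part_eq0 (T := @im R k)) gi => [z w|a z|z].
- exact: imD.
- by rewrite imM re_mkscalar im_mkscalar0 mul0r addr0.
- exact: le_im_modulus.
Qed.

Lemma halving_invariant_eq0 u : D u = 0.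
Proof.
rewrite -(L1_reprK u); move: (repr u) => f; have [D_lin _] := D_blf.
have [rf imf] := integrable_funP f.
pose fr := to_integrable_fun (lift_integrable rf).
pose fi := to_integrable_fun (lift_integrable imf).
(* Linearity over the base field reduces the claim to the lifted real and imaginary parts of f. *)
have -> : f = mkscalar k 0 1 *: fi + fr.
  by apply: val_inj; apply/funext => x; exact: scalar_re_im.
rewrite L1_classD L1_classZ D_lin -(ED (h := fr) rf)// -(ED (h := fi) imf)// !E_eq0//.
by rewrite scaler0 addr0.
Qed.

End Uniqueness.

Theorem corollary2p3 (R : realType) (k : scalars) :
  [/\ bounded_linear_functional (@L1_integral R k),
      L1_integral (L1_one R k) = 1
    & halving_invariant (@L1_integral R k)] /\
  (forall Phi : L1 R k -> base_field R k,
     bounded_linear_functional Phi ->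
     Phi (L1_one R k) = 1 ->
     halving_invariant Phi ->
     Phi = @L1_integral R k).
Proof.
have [Il [N Ile]] := bounded_linear_L1_integral R k.
have I1 := L1_integral_one R k.
have Ih := @halving_invariant_L1_integral R k.
split=> [|Phi [Pl [M Ple]] P1 Ph]; first by split=> //; split=> //; exists N.
apply/funext => u; apply/eqP; rewrite -subr_eq0; apply/eqP.
apply: (halving_invariant_eq0 (D := fun v => Phi v - L1_integral v)).
- split=> [a v w|].
    by rewrite Pl Il scalerBr opprD addrACA.
  by exists (M + N) => v; rewrite mulrDl (le_trans (ler_normB _ _))// lerD.
- by move=> f; rewrite Ph Ih -mulrBr opprD addrACA.
- by rewrite P1 I1 subrr.
Qed.
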